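(* Let $S$ be a $\vee$-semilattice with minimum $0$ and let $\prec$ be a binary relation on $S$ that is distributive and auxiliary. Let $I\subseteq S$ be an ideal and let $F\subseteq S$ be a round filter with $I\cap F=\emptyset$. Then there is a round prime filter $P\subseteq S$ with $F\subseteq P$ and $I\cap P=\emptyset$.
   Context: A $\vee$-semilattice is a poset $(S,\leq)$ with binary joins $\vee$. A filter is a subset $F\subseteq S$ such that for all $p,q\in S$: $p,q\in F$ iff there is $r\in F$ with $r\leq p$ and $r\leq q$. An ideal is a subset $I\subseteq S$ such that for all $p,q\in S$: $p,q\in I$ iff there is $r\in I$ with $r\geq p$ and $r\geq q$. A filter $P$ is prime if $S\setminus P$ is an ideal. A filter $R$ is round if for every $p\in R$ there is $r\in R$ with $r\prec p$. $\prec$ is distributive if for all $p,s,t\in S$: $p\prec s\vee t$ implies that for every $p'\prec p$ there are $s'\prec s$ and $t'\prec t$ with $p'\leq s'\vee t'\leq p$. $\prec$ is auxiliary if for all $p,p',q,q'\in S$: $p\leq p'\prec q'\leq q$ implies $p\prec q$, and $p\prec q$ implies $p\leq q$. *)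

(* Defs.v *)
From HB Require Import structures.
From mathcomp Require Import all_boot all_order.
From mathcomp Require Import boolp classical_sets.
Set Implicit Arguments.
Unset Strict Implicit.
Unset Printing Implicit Defensive.
Import Order.Theory.
Local Open Scope classical_set_scope.
Local Open Scope order_scope.

(* As in the defining equivalence, the empty set is both a filter and an
   ideal. *)
Definition order_filter (d : Order.disp_t) (S : porderType d) (F : set S) :
    Prop :=
  forall p q : S, (F p /\ F q) <-> exists r : S, [/\ F r, r <= p & r <= q].

Definition order_ideal (d : Order.disp_t) (S : porderType d) (I : set S) :
    Prop :=
  forall p q : S, (I p /\ I q) <-> exists r : S, [/\ I r, p <= r & q <= r].

Definition prime_order_filter (d : Order.disp_t) (S : porderType d)
    (P : set S) : Prop :=
  order_filter P /\ order_ideal (~` P)%classic.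

Definition round (S : Type) (prec : S -> S -> Prop) (R : set S) : Prop :=
  forall p : S, R p -> exists2 r : S, R r & prec r p.

Definition distributive_rel (d : Order.disp_t) (S : joinSemilatticeType d)
    (prec : S -> S -> Prop) : Prop :=
  forall p s t : S, prec p (s `|` t) ->
  forall p' : S, prec p' p ->
  exists s' t' : S,
    [/\ prec s' s, prec t' t, p' <= s' `|` t' & s' `|` t' <= p].

Definition auxiliary_rel (d : Order.disp_t) (S : porderType d)
    (prec : S -> S -> Prop) : Prop :=
  (forall p p' q q' : S, p <= p' -> prec p' q' -> q' <= q -> prec p q) /\
  (forall p q : S, prec p q -> p <= q).

(* Main.v *)
Require Import Defs.
From HB Require Import structures.
From mathcomp Require Import all_boot all_order.
From mathcomp Require Import boolp classical_sets.
Import Order.Theory.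
Local Open Scope classical_set_scope.
Local Open Scope order_scope.

(** The complement of an ideal [J] maximal among the ideals containing [I] and
    disjoint from [F] is the required filter. If [p] and [q] lie outside [J], maximality gives
    [j] in [J] and [f] in [F] below both [j `|` p] and [j `|` q]. Descending
    through [F] and applying distributivity first to [j `|` p] and then to
    [j `|` q] yields [r <= p] with [prec r q] such that [J] and [r]
    together still generate an element of [F]; hence [r] is outside [J]. This
    gives directedness of the complement, and roundness when [p = q]. *)

Lemma order_idealP (d : Order.disp_t) (S : joinSemilatticeType d) (I : set S) :
  order_ideal I <->
  (forall p q, q <= p -> I p -> I q) /\
  (forall p q, I p -> I q -> I (p `|` q)).
Proof.
split=> [idI | [dnI joinI] p q].
  have dnI p q : q <= p -> I p -> I q.
    by move=> qp Ip; have [] := (idI q q).2 (ex_intro _ p (And3 Ip qp qp)).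
  split=> // p q Ip Iq; have [r [Ir pr qr]] := (idI p q).1 (conj Ip Iq).
  by apply: dnI Ir; rewrite leUx pr qr.
split=> [[Ip Iq] | [r [Ir pr qr]]]; last by split; apply: dnI Ir.
by exists (p `|` q); split; [exact: joinI | exact: leUl | exact: leUr].
Qed.

(** For nonempty [J] this is the ideal generated by [J] and [p]; for empty [J] it is empty and
    misses [p]. *)
Lemma order_ideal_adjoin (d : Order.disp_t) (S : joinSemilatticeType d)
    (J : set S) (p : S) :
  order_ideal J -> order_ideal [set x | exists2 j, J j & x <= j `|` p].
Proof.
move=> /order_idealP[_ joinJ]; apply/order_idealP; split=> /= x y.
  by move=> yx [j Jj xj]; exists j => //; apply: le_trans xj.
move=> [j Jj xj] [k Jk yk]; exists (j `|` k); first exact: joinJ.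
by rewrite leUx (le_trans xj) ?(le_trans yk) // leU2 ?leUl ?leUr.
Qed.

Lemma maximal_disjoint_ideal (d : Order.disp_t) (S : joinSemilatticeType d)
    (I F : set S) :
  order_ideal I -> I !=set0 -> (forall x, I x -> ~ F x) ->
  exists J : set S,
    [/\ order_ideal J, I `<=` J, (forall x, J x -> ~ F x)
      & forall p, ~ J p -> exists j f, [/\ J j, F f & f <= j `|` p]].
Proof.
move=> idI [i0 Ii0] IF.
(* [Zorn_bigcup] also considers the empty chain, so [set0] must be allowed. *)
pose Q (J : set S) :=
  [/\ order_ideal J, J !=set0 -> I `<=` J & forall x, J x -> ~ F x].
have [|J [[idJ IJ JF] maxJ]] := @Zorn_bigcup S Q.
  move=> C CQ totC; split.
  - apply/order_idealP; split=> p q.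
      move=> qp [X CX Xp]; exists X => //.
      by have [/order_idealP[dnX _] _ _] := CQ X CX; apply: dnX Xp.
    move=> [X CX Xp] [Y CY Yq].
    have [XY | YX] := totC X Y CX CY.
      exists Y => //; have [/order_idealP[_ joinY] _ _] := CQ Y CY.
      by apply: joinY => //; apply: XY.
    exists X => //; have [/order_idealP[_ joinX] _ _] := CQ X CX.
    by apply: joinX => //; apply: YX.
  - move=> [x [X CX Xx]] y Iy; exists X => //.
    by have [_ IX _] := CQ X CX; apply: IX Iy; exists x.
  - by move=> x [X CX Xx]; have [_ _ XF] := CQ X CX; apply: XF.
(* Were [J] empty, the nonempty ideal [I] would be a strictly larger member of [Q]. *)
have [j0 Jj0] : J !=set0.
  apply: contrapT => J0; apply: (maxJ I); last by split=> // _ x.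
  split=> [x Jx | IJ0]; first by case: J0; exists x.
  by apply: J0; exists i0; apply: IJ0.
have {}IJ : I `<=` J by apply: IJ; exists j0.
exists J; split=> // p nJp; apply: contrapT => nF.
have JK : J `<=` [set x | exists2 j, J j & x <= j `|` p].
  by move=> x Jx; exists x => //; apply: leUl.
(* Adjoining [p] enlarges [J] strictly, so only meeting [F] can keep the result out of [Q]. *)
apply: (maxJ [set x | exists2 j, J j & x <= j `|` p]).
  by split=> // KJ; apply: nJp; apply: KJ; exists j0 => //; apply: leUr.
split=> [|_|x [j Jj xj] Fx]; first exact: order_ideal_adjoin.
  exact: subset_trans JK.
by apply: nF; exists j, x.
Qed.

Lemma distributive_interpolation (d : Order.disp_t)
    (S : joinSemilatticeType d) (prec : S -> S -> Prop) (J F : set S)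
    (j f p q : S) :
  distributive_rel prec -> auxiliary_rel prec ->
  order_ideal J -> round prec F -> (forall x, J x -> ~ F x) ->
  J j -> F f -> f <= j `|` p -> f <= j `|` q ->
  exists r, [/\ ~ J r, r <= p & prec r q].
Proof.
move=> dis [aux le_prec] /order_idealP[dnJ joinJ] rF JF Jj Ff fp fq.
have [f1 Ff1 f1f] := rF f Ff; have [f2 Ff2 f21] := rF f1 Ff1.
have [f3 Ff3 f32] := rF f2 Ff2; have [f4 Ff4 f43] := rF f3 Ff3.
have [s [t [sj tp f2st stf1]]] := dis _ _ _ (aux _ _ _ _ (lexx _) f1f fp) _ f21.
(* Distributivity splits only elements [prec]-below [t]. This intermediate use supplies such a [t1],
   with [s1] in [J] and [f4] still below the join of [s1] and [t1]. *)
have [s1 [t1 [s1s t1t f4st _]]] :=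
  dis _ _ _ (aux _ _ _ _ (lexx _) f32 f2st) _ f43.
(* The upper bound [f1] from the first splitting puts [t] [prec]-below [j] joined with [q], so [t1]
   splits in turn. *)
have tf1 : t <= f1 by apply: le_trans stf1; apply: leUr.
have [s2 [r [s2j rq t1sr srt]]] := dis _ _ _ (aux _ _ _ _ tf1 f1f fq) _ t1t.
exists r; split=> //; last first.
  by apply: le_trans (le_prec _ _ tp); apply: le_trans srt; apply: leUr.
move=> Jr; apply: (JF _ _ Ff4); apply: (dnJ (s1 `|` (s2 `|` r))).
  by apply: le_trans f4st _; apply: leU2.
have Js1 : J s1.
  by apply: dnJ Jj; apply: le_trans (le_prec _ _ sj); apply: le_prec.
have Js2 : J s2 by apply: dnJ Jj; apply: le_prec.
exact: (joinJ _ _ Js1 (joinJ _ _ Js2 Jr)).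
Qed.

Theorem theorem2p4 (d : Order.disp_t) (S : bJoinSemilatticeType d)
    (prec : S -> S -> Prop) (I F : set S) :
  distributive_rel prec -> auxiliary_rel prec ->
  order_ideal I ->
  order_filter F -> round prec F ->
  (I `&` F = set0)%classic ->
  exists P : set S,
    [/\ prime_order_filter P, round prec P, (F `<=` P)%classic
      & (I `&` P = set0)%classic].
Proof.
move=> dis aux /order_idealP[dnI joinI] filF rF IF0.
have IF x : I x -> ~ F x.
  by move=> Ix Fx; have : (I `&` F)%classic x by []; rewrite IF0.
(* If [F] contains [\bot] it is all of [S], and its empty complement is an ideal. Otherwise [\bot]
   can be added to [I] without meeting [F]. *)
have [F0 | nF0] := pselect (F \bot).
  exists F; split=> //; split=> //.
  have FT x : F x.
    by have [] := (filF x x).2 (ex_intro _ \bot (And3 F0 (le0x x) (le0x x))).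
  by apply/order_idealP; split=> p q => [_|] nFp; case: nFp.
(* [I] may be empty, while the maximality argument needs a nonempty ideal. *)
have [||x [Ix|->]//|J [idJ IJ JF maxJ]] :=
    @maximal_disjoint_ideal d S (I `|` [set \bot])%classic F.
- apply/order_idealP; split=> p q.
    move=> qp [Ip | p0]; first by left; apply: dnI Ip.
    by right; move: qp; rewrite p0 lex0 => /eqP.
  move=> [Ip | ->]; last by rewrite join0x.
  by move=> [Iq | ->]; left; [exact: joinI | rewrite joinx0].
- by exists \bot; right.
- exact: IF.
have interp p q : ~ J p -> ~ J q -> exists r, [/\ ~ J r, r <= p & prec r q].
  move=> /maxJ[j [f [Jj Ff fj]]] /maxJ[k [g [Jk Fg gk]]].
  (* The two witness pairs merge: a common lower bound in [F], and the join of [j] and [k] in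
     [J]. *)
  have [h [Fh hf hg]] := (filF f g).1 (conj Ff Fg).
  have Jjk : J (j `|` k) by apply: ((order_idealP _ _ J).1 idJ).2.
  apply: (distributive_interpolation _ _ _ _ _ _ _ _ _
    dis aux idJ rF JF Jjk Fh).
    by apply: le_trans hf _; apply: le_trans fj _; rewrite leU2 ?leUl.
  by apply: le_trans hg _; apply: le_trans gk _; rewrite leU2 ?leUr.
have [dnJ _] := (order_idealP _ _ J).1 idJ.
exists (~` J)%classic; split.
- split; last by rewrite setCK.
  move=> p q; split=> [[nJp nJq] | [r [nJr rp rq]]].
    have [r [nJr rp rq]] := interp p q nJp nJq.
    by exists r; split=> //; apply: aux.2.
  by split=> Jx; apply: nJr; apply: dnJ Jx.
- by move=> p nJp; have [r [nJr _ rp]] := interp p p nJp nJp; exists r.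
- by move=> x Fx Jx; apply: JF Fx.
- by apply/seteqP; split=> x //= [Ix]; apply; apply: IJ; left.
Qed.
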